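(* Let $\mathfrak{g}$ be a Leibniz algebra over a field $k$, $V$ a $k$-vector space and $\Omega(\mathfrak{g},V)=(\triangleleft,\triangleright,\leftharpoonup,\rightharpoonup,f,\{-,-\})$ an extending datum of $\mathfrak{g}$ through $V$. Then $\mathfrak{g}\ltimes V$ is a unified product (that is, $\mathfrak{g}\times V$ with the bracket $$[(g,x),(h,y)]=\bigl([g,h]+x\triangleright h+g\leftharpoonup y+f(x,y),\ \{x,y\}+x\triangleleft h+g\rightharpoonup y\bigr)$$ is a Leibniz algebra) if and only if the following conditions hold for all $g,h\in\mathfrak{g}$ and $x,y,z\in V$: (L1) $x\triangleleft[g,h]=(x\triangleleft g)\triangleleft h-(x\triangleleft h)\triangleleft g$; (L2) $x\triangleright[g,h]=[x\triangleright g,h]-[x\triangleright h,g]+(x\triangleleft g)\triangleright h-(x\triangleleft h)\triangleright g$; (L3) $[g,h]\rightharpoonup x=g\rightharpoonup(h\rightharpoonup x)+(g\rightharpoonup x)\triangleleft h$; (L4) $[g,h]\leftharpoonup x=[g,h\leftharpoonup x]+[g\leftharpoonup x,h]+g\leftharpoonup(h\rightharpoonup x)+(g\rightharpoonup x)\triangleright h$; (L5) $x\triangleright f(y,z)=f(x,y)\leftharpoonup z-f(x,z)\leftharpoonup y+f(\{x,y\},z)-f(\{x,z\},y)-f(x,\{y,z\})$; (L6) $x\triangleleft f(y,z)=f(x,y)\rightharpoonup z-f(x,z)\rightharpoonup y+\{\{x,y\},z\}-\{\{x,z\},y\}-\{x,\{y,z\}\}$; (L7) $\{x,y\}\triangleright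 g=x\triangleright(y\triangleright g)+(x\triangleright g)\leftharpoonup y+f(x,y\triangleleft g)+f(x\triangleleft g,y)-[f(x,y),g]$; (L8) $\{x,y\}\triangleleft g=x\triangleleft(y\triangleright g)+(x\triangleright g)\rightharpoonup y+\{x,y\triangleleft g\}+\{x\triangleleft g,y\}$; (L9) $g\rightharpoonup\{x,y\}=(g\leftharpoonup x)\rightharpoonup y-(g\leftharpoonup y)\rightharpoonup x+\{g\rightharpoonup x,y\}-\{g\rightharpoonup y,x\}$; (L10) $g\leftharpoonup\{x,y\}=(g\leftharpoonup x)\leftharpoonup y-(g\leftharpoonup y)\leftharpoonup x+f(g\rightharpoonup x,y)-f(g\rightharpoonup y,x)-[g,f(x,y)]$; (L11) $[g,h\leftharpoonup x]+[g,x\triangleright h]+g\leftharpoonup(h\rightharpoonup x)+g\leftharpoonup(x\triangleleft h)=0$; (L12) $x\triangleright(y\triangleright g)+x\triangleright(g\leftharpoonup y)+f(x,y\triangleleft g)+f(x,g\rightharpoonup y)=0$; (L13) $x\triangleleft(y\triangleright g)+x\triangleleft(g\leftharpoonup y)+\{x,y\triangleleft g\}+\{x,g\rightharpoonup y\}=0$; (L14) $g\rightharpoonup(h\rightharpoonup x)+g\rightharpoonup(x\triangleleft h)=0$.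
   Context: All vector spaces, linear and bilinear maps are over an arbitrary field $k$. A Leibniz algebra is a vector space $\mathfrak{g}$ with a bilinear map $[-,-]:\mathfrak{g}\times\mathfrak{g}\to\mathfrak{g}$ satisfying $[g,[h,l]]=[[g,h],l]-[[g,l],h]$ for all $g,h,l\in\mathfrak{g}$. An extending datum of a Leibniz algebra $\mathfrak{g}$ through a vector space $V$ is a system $\Omega(\mathfrak{g},V)=(\triangleleft,\triangleright,\leftharpoonup,\rightharpoonup,f,\{-,-\})$ of six arbitrary bilinear maps $\triangleleft:V\times\mathfrak{g}\to V$, $\triangleright:V\times\mathfrak{g}\to\mathfrak{g}$, $\leftharpoonup:\mathfrak{g}\times V\to\mathfrak{g}$, $\rightharpoonup:\mathfrak{g}\times V\to V$, $f:V\times V\to\mathfrak{g}$, $\{-,-\}:V\times V\to V$. Given such a datum, $\mathfrak{g}\ltimes V$ denotes the vector space $\mathfrak{g}\times V$ together with the bilinear bracket displayed in the claim; it is called a unified product if this bracket makes it a Leibniz algebra. *)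

(* Defs.v *)
From HB Require Import structures.
From mathcomp Require Import all_boot all_algebra.
Set Implicit Arguments.
Unset Strict Implicit.
Unset Printing Implicit Defensive.
Import GRing.Theory.
Local Open Scope ring_scope.

(* Right Leibniz algebras: each [-, l] is a derivation. *)
Record is_leibniz_bracket (k : fieldType) (L : lmodType k)
    (br : L -> L -> L) : Prop := IsLeibnizBracket {
  leibniz_bilinear : bilinear_for *:%R *:%R br;
  leibniz_identity : forall g h l : L,
    br g (br h l) = br (br g h) l - br (br g l) h
}.

HB.mixin Record Lmodule_isLeibniz (k : fieldType) L & GRing.Lmodule k L := {
  leibniz_bracket : L -> L -> L;
  leibniz_bracketP : is_leibniz_bracket leibniz_bracket
}.

#[short(type="leibnizAlgType")]
HB.structure Definition LeibnizAlgebra (k : fieldType) :=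
  {L of GRing.Lmodule k L & Lmodule_isLeibniz k L}.

Record extending_datum (k : fieldType) (g : leibnizAlgType k) (V : lmodType k) :=
  ExtendingDatum {
    ed_triangleleft : {bilinear V -> g -> V};
    ed_triangleright : {bilinear V -> g -> g};
    ed_leftharpoon : {bilinear g -> V -> g};
    ed_rightharpoon : {bilinear g -> V -> V};
    ed_cocycle : {bilinear V -> V -> g};
    ed_bracket : {bilinear V -> V -> V}
  }.

Section UnifiedProduct.
Variables (k : fieldType) (g : leibnizAlgType k) (V : lmodType k).
Variable Omega : extending_datum g V.

Local Notation "⟦ a , b ⟧" := (leibniz_bracket a b)
  (at level 0, a at level 99, b at level 99).
Local Notation "x ◁ a" := (ed_triangleleft Omega x a)
  (at level 35, no associativity).
Local Notation "x ▷ a" := (ed_triangleright Omega x a)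
  (at level 35, no associativity).
Local Notation "a ↼ x" := (ed_leftharpoon Omega a x)
  (at level 35, no associativity).
Local Notation "a ⇀ x" := (ed_rightharpoon Omega a x)
  (at level 35, no associativity).
Local Notation f := (ed_cocycle Omega).
Local Notation "⦃ x , y ⦄" := (ed_bracket Omega x y)
  (at level 0, x at level 99, y at level 99).

Definition unified_bracket (u v : g * V) : g * V :=
  let: (a, x) := u in
  let: (b, y) := v in
  (⟦a, b⟧ + x ▷ b + a ↼ y + f x y, ⦃x, y⦄ + x ◁ b + a ⇀ y).

Definition is_unified_product : Prop := is_leibniz_bracket unified_bracket.

Record unified_product_conditions : Prop := UnifiedProductConditions {
  condL1 : forall (a b : g) (x : V),
    x ◁ ⟦a, b⟧ = (x ◁ a) ◁ b - (x ◁ b) ◁ a;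
  condL2 : forall (a b : g) (x : V),
    x ▷ ⟦a, b⟧ = ⟦x ▷ a, b⟧ - ⟦x ▷ b, a⟧ + (x ◁ a) ▷ b - (x ◁ b) ▷ a;
  condL3 : forall (a b : g) (x : V),
    ⟦a, b⟧ ⇀ x = a ⇀ (b ⇀ x) + (a ⇀ x) ◁ b;
  condL4 : forall (a b : g) (x : V),
    ⟦a, b⟧ ↼ x = ⟦a, b ↼ x⟧ + ⟦a ↼ x, b⟧ + a ↼ (b ⇀ x) + (a ⇀ x) ▷ b;
  condL5 : forall x y z : V,
    x ▷ f y z = f x y ↼ z - f x z ↼ y
                + f ⦃x, y⦄ z - f ⦃x, z⦄ y - f x ⦃y, z⦄;
  condL6 : forall x y z : V,
    x ◁ f y z = f x y ⇀ z - f x z ⇀ y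
                + ⦃⦃x, y⦄, z⦄ - ⦃⦃x, z⦄, y⦄ - ⦃x, ⦃y, z⦄⦄;
  condL7 : forall (a : g) (x y : V),
    ⦃x, y⦄ ▷ a = x ▷ (y ▷ a) + (x ▷ a) ↼ y
                 + f x (y ◁ a) + f (x ◁ a) y - ⟦f x y, a⟧;
  condL8 : forall (a : g) (x y : V),
    ⦃x, y⦄ ◁ a = x ◁ (y ▷ a) + (x ▷ a) ⇀ y + ⦃x, y ◁ a⦄ + ⦃x ◁ a, y⦄;
  condL9 : forall (a : g) (x y : V),
    a ⇀ ⦃x, y⦄ = (a ↼ x) ⇀ y - (a ↼ y) ⇀ x + ⦃a ⇀ x, y⦄ - ⦃a ⇀ y, x⦄;
  condL10 : forall (a : g) (x y : V),
    a ↼ ⦃x, y⦄ = (a ↼ x) ↼ y - (a ↼ y) ↼ x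
                 + f (a ⇀ x) y - f (a ⇀ y) x - ⟦a, f x y⟧;
  condL11 : forall (a b : g) (x : V),
    ⟦a, b ↼ x⟧ + ⟦a, x ▷ b⟧ + a ↼ (b ⇀ x) + a ↼ (x ◁ b) = 0;
  condL12 : forall (a : g) (x y : V),
    x ▷ (y ▷ a) + x ▷ (a ↼ y) + f x (y ◁ a) + f x (a ⇀ y) = 0;
  condL13 : forall (a : g) (x y : V),
    x ◁ (y ▷ a) + x ◁ (a ↼ y) + ⦃x, y ◁ a⦄ + ⦃x, a ⇀ y⦄ = 0;
  condL14 : forall (a b : g) (x : V),
    a ⇀ (b ⇀ x) + a ⇀ (x ◁ b) = 0
}.

End UnifiedProduct.

(* Main.v *)
Require Import Defs.
From HB Require Import structures.
From mathcomp Require Import all_boot all_algebra.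

(** Both sides of the Leibniz identity are additive in each argument, so for
    the bracket on [g * V] the identity only has to be tested on triples whose
    entries lie in [g] or in [V].  The triple (g,g,g) gives nothing new, and
    (V,g,g), (g,g,V), (V,V,V), (V,V,g), (g,V,V) give, componentwise, (L1)-(L2),
    (L3)-(L4), (L5)-(L6), (L7)-(L8) and (L9)-(L10).  As the right-hand side
    of the identity is antisymmetric in its last two arguments, the remaining
    triples (g,V,g) and (V,g,V) amount to [u, [v, w] + [w, v]] = 0, that is, to
    (L11), (L14) and (L12), (L13). *)

Set Implicit Arguments.
Unset Strict Implicit.
Unset Printing Implicit Defensive.
Import GRing.Theory.
Local Open Scope ring_scope.

(** Swaps [t] with its right neighbour until nothing follows it. A summand and its opposite moved
    this way become adjacent, and [addrK] cancels them. *)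
Ltac move_last t := do ?rewrite [_ + t + _]addrAC.

(* The leading 0 makes [addrAC] applicable to the first summand as well. *)
Ltac zmod_eq :=
  apply: subr0_eq; rewrite -[LHS]add0r;
  rewrite ?(opprD, opprK, addrA, oppr0, addr0);
  repeat match goal with |- context [- ?t] =>
    move_last t; move_last (- t); rewrite addrK end;
  by [].

Section LeibnizDefect.
Variables (k : fieldType) (L : lmodType k).

Definition leibniz_defect (br : L -> L -> L) (u v w : L) : L :=
  br u (br v w) - (br (br u v) w - br (br u w) v).

(** The two iterated left brackets change sign when [v] and [w] are exchanged, so they cancel in the
    sum. *)
Lemma leibniz_defect_swap br u v w :
  leibniz_defect br u v w + leibniz_defect br u w v
    = br u (br v w) + br u (br w v).
Proof. by rewrite /leibniz_defect; zmod_eq. Qed.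

Variable br : {bilinear L -> L -> L}.

Lemma leibniz_defectDl u u' v w :
  leibniz_defect br (u + u') v w
    = leibniz_defect br u v w + leibniz_defect br u' v w.
Proof. by rewrite /leibniz_defect !linearDl; zmod_eq. Qed.

Lemma leibniz_defectDm u v v' w :
  leibniz_defect br u (v + v') w
    = leibniz_defect br u v w + leibniz_defect br u v' w.
Proof.
by rewrite /leibniz_defect !(linearDl, linearDr); zmod_eq.
Qed.

Lemma leibniz_defectDr u v w w' :
  leibniz_defect br u v (w + w')
    = leibniz_defect br u v w + leibniz_defect br u v w'.
Proof.
by rewrite /leibniz_defect !(linearDl, linearDr); zmod_eq.
Qed.

End LeibnizDefect.

(** Lets the generic lemmas on bilinear maps, such as [linear0l] and [linear0r], apply to the
    bracket of [g]. *)
HB.instance Definition _ (k : fieldType) (g : leibnizAlgType k) :=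
  bilinear_isBilinear.Build k g g g *:%R *:%R (@leibniz_bracket k g)
    (leibniz_bilinear leibniz_bracketP).

Section UnifiedProductTheory.
Variables (k : fieldType) (g : leibnizAlgType k) (V : lmodType k).
Variable Omega : extending_datum g V.

Local Notation "⟦ a , b ⟧" := (leibniz_bracket a b)
  (at level 0, a at level 99, b at level 99).
Local Notation "x ◁ a" := (ed_triangleleft Omega x a)
  (at level 35, no associativity).
Local Notation "x ▷ a" := (ed_triangleright Omega x a)
  (at level 35, no associativity).
Local Notation "a ↼ x" := (ed_leftharpoon Omega a x)
  (at level 35, no associativity).
Local Notation "a ⇀ x" := (ed_rightharpoon Omega a x)
  (at level 35, no associativity).
Local Notation f := (ed_cocycle Omega).
Local Notation "⦃ x , y ⦄" := (ed_bracket Omega x y)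
  (at level 0, x at level 99, y at level 99).

(** Inherited from the bracket of [g] and the six maps of the datum. It settles one half of
    [is_unified_product] and makes the defect additive in each argument. *)
Lemma unified_bracket_bilinear :
  bilinear_for *:%R *:%R (unified_bracket Omega).
Proof.
split=> [[b y]|[b y]] c [a x] [a' x']; congr pair => /=.
- by rewrite !linearPl !scalerDr; zmod_eq.
- by rewrite !linearPl !scalerDr; zmod_eq.
- by rewrite !linearPr !scalerDr; zmod_eq.
- by rewrite !linearPr !scalerDr; zmod_eq.
Qed.

HB.instance Definition _ :=
  bilinear_isBilinear.Build k (g * V)%type (g * V)%type (g * V)%type *:%R *:%R
    (unified_bracket Omega) unified_bracket_bilinear.

Local Notation defect := (leibniz_defect (unified_bracket Omega)).
Local Notation inG a := ((a, 0) : g * V).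
Local Notation inV x := ((0, x) : g * V).

Let bracket0 := (@linear0l, @linear0r, addr0, add0r).

Lemma unified_bracket_gg a b :
  unified_bracket Omega (inG a) (inG b) = inG ⟦a, b⟧.
Proof. by rewrite /= !bracket0. Qed.

Lemma unified_bracket_gV a x :
  unified_bracket Omega (inG a) (inV x) = (a ↼ x, a ⇀ x).
Proof. by rewrite /= !bracket0. Qed.

Lemma unified_bracket_Vg x a :
  unified_bracket Omega (inV x) (inG a) = (x ▷ a, x ◁ a).
Proof. by rewrite /= !bracket0. Qed.

Lemma unified_bracket_VV x y :
  unified_bracket Omega (inV x) (inV y) = (f x y, ⦃x, y⦄).
Proof. by rewrite /= !bracket0. Qed.

Let bracketE :=
  (unified_bracket_gg, unified_bracket_gV, unified_bracket_Vg,
   unified_bracket_VV).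

(** The first summand is closed under the bracket and carries that of [g], so the Leibniz identity
    of [g] suffices. *)
Lemma defect_ggg a b c : defect (inG a) (inG b) (inG c) = 0.
Proof.
by rewrite /leibniz_defect !bracketE (leibniz_identity leibniz_bracketP);
  congr pair; rewrite /= !subrr.
Qed.

(** Each component is the difference of the two sides of one condition, so its vanishing is exactly
    that condition. The next four formulas are arranged likewise. *)
Lemma defect_Vgg x a b :
  defect (inV x) (inG a) (inG b)
    = (x ▷ ⟦a, b⟧
         - (⟦x ▷ a, b⟧ - ⟦x ▷ b, a⟧ + (x ◁ a) ▷ b - (x ◁ b) ▷ a),
       x ◁ ⟦a, b⟧ - ((x ◁ a) ◁ b - (x ◁ b) ◁ a)).
Proof.
by rewrite /leibniz_defect !bracketE; congr pair;
  rewrite /= !bracket0; zmod_eq.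
Qed.

(** Here, and for (V,V,g), the left side of each condition comes from [br (br u v) w], which enters
    the defect with a minus sign; hence right side minus left side. *)
Lemma defect_ggV a b x :
  defect (inG a) (inG b) (inV x)
    = (⟦a, b ↼ x⟧ + ⟦a ↼ x, b⟧ + a ↼ (b ⇀ x) + (a ⇀ x) ▷ b - ⟦a, b⟧ ↼ x,
       a ⇀ (b ⇀ x) + (a ⇀ x) ◁ b - ⟦a, b⟧ ⇀ x).
Proof.
by rewrite /leibniz_defect !bracketE; congr pair;
  rewrite /= !bracket0; zmod_eq.
Qed.

Lemma defect_VVV x y z :
  defect (inV x) (inV y) (inV z)
    = (x ▷ f y z - (f x y ↼ z - f x z ↼ y
                    + f ⦃x, y⦄ z - f ⦃x, z⦄ y - f x ⦃y, z⦄),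
       x ◁ f y z - (f x y ⇀ z - f x z ⇀ y
                    + ⦃⦃x, y⦄, z⦄ - ⦃⦃x, z⦄, y⦄ - ⦃x, ⦃y, z⦄⦄)).
Proof.
by rewrite /leibniz_defect !bracketE; congr pair;
  rewrite /= !bracket0; zmod_eq.
Qed.

Lemma defect_VVg x y a :
  defect (inV x) (inV y) (inG a)
    = (x ▷ (y ▷ a) + (x ▷ a) ↼ y + f x (y ◁ a) + f (x ◁ a) y - ⟦f x y, a⟧
         - ⦃x, y⦄ ▷ a,
       x ◁ (y ▷ a) + (x ▷ a) ⇀ y + ⦃x, y ◁ a⦄ + ⦃x ◁ a, y⦄ - ⦃x, y⦄ ◁ a).
Proof.
by rewrite /leibniz_defect !bracketE; congr pair;
  rewrite /= !bracket0; zmod_eq.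
Qed.

Lemma defect_gVV a x y :
  defect (inG a) (inV x) (inV y)
    = (a ↼ ⦃x, y⦄
         - ((a ↼ x) ↼ y - (a ↼ y) ↼ x
            + f (a ⇀ x) y - f (a ⇀ y) x - ⟦a, f x y⟧),
       a ⇀ ⦃x, y⦄
         - ((a ↼ x) ⇀ y - (a ↼ y) ⇀ x + ⦃a ⇀ x, y⦄ - ⦃a ⇀ y, x⦄)).
Proof.
by rewrite /leibniz_defect !bracketE; congr pair;
  rewrite /= !bracket0; zmod_eq.
Qed.

(** The right side is the bracket of [a] with the symmetrised product of [b] and [x], which is
    [(b ↼ x + x ▷ b, b ⇀ x + x ◁ b)]. *)
Lemma defect_ggV_swap a b x :
  defect (inG a) (inG b) (inV x) + defect (inG a) (inV x) (inG b)
    = (⟦a, b ↼ x⟧ + ⟦a, x ▷ b⟧ + a ↼ (b ⇀ x) + a ↼ (x ◁ b),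
       a ⇀ (b ⇀ x) + a ⇀ (x ◁ b)).
Proof.
by rewrite leibniz_defect_swap !bracketE; congr pair;
  rewrite /= !bracket0; zmod_eq.
Qed.

Lemma defect_VVg_swap x y a :
  defect (inV x) (inV y) (inG a) + defect (inV x) (inG a) (inV y)
    = (x ▷ (y ▷ a) + x ▷ (a ↼ y) + f x (y ◁ a) + f x (a ⇀ y),
       x ◁ (y ▷ a) + x ◁ (a ↼ y) + ⦃x, y ◁ a⦄ + ⦃x, a ⇀ y⦄).
Proof.
by rewrite leibniz_defect_swap !bracketE; congr pair;
  rewrite /= !bracket0; zmod_eq.
Qed.

Lemma is_unified_productP :
  is_unified_product Omega <-> forall u v w, defect u v w = 0.
Proof.
split=> [[_ Leib] u v w | defect0]; first by rewrite /leibniz_defect Leib subrr.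
split; first exact: unified_bracket_bilinear.
by move=> u v w; apply/subr0_eq/defect0.
Qed.

Lemma unified_product_conditions_necessary :
  (forall u v w, defect u v w = 0) -> unified_product_conditions Omega.
Proof.
move=> defect0.
have Vgg x a b := etrans (esym (defect_Vgg x a b)) (defect0 _ _ _).
have ggV a b x := etrans (esym (defect_ggV a b x)) (defect0 _ _ _).
have VVV x y z := etrans (esym (defect_VVV x y z)) (defect0 _ _ _).
have VVg x y a := etrans (esym (defect_VVg x y a)) (defect0 _ _ _).
have gVV a x y := etrans (esym (defect_gVV a x y)) (defect0 _ _ _).
have gVg a b x := esym (defect_ggV_swap a b x).
have VgV x y a := esym (defect_VVg_swap x y a).
split.
(* Each equation between pairs serves two conditions, one per component. *)
- by move=> a b x; apply: subr0_eq; case: (Vgg x a b).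
- by move=> a b x; apply: subr0_eq; case: (Vgg x a b).
- by move=> a b x; apply/esym/subr0_eq; case: (ggV a b x).
- by move=> a b x; apply/esym/subr0_eq; case: (ggV a b x).
- by move=> x y z; apply: subr0_eq; case: (VVV x y z).
- by move=> x y z; apply: subr0_eq; case: (VVV x y z).
- by move=> a x y; apply/esym/subr0_eq; case: (VVg x y a).
- by move=> a x y; apply/esym/subr0_eq; case: (VVg x y a).
- by move=> a x y; apply: subr0_eq; case: (gVV a x y).
- by move=> a x y; apply: subr0_eq; case: (gVV a x y).
- by move=> a b x; move: (gVg a b x); rewrite !defect0 addr0; case.
- by move=> a x y; move: (VgV x y a); rewrite !defect0 addr0; case.
- by move=> a x y; move: (VgV x y a); rewrite !defect0 addr0; case.
- by move=> a b x; move: (gVg a b x); rewrite !defect0 addr0; case.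
Qed.

Lemma unified_product_conditions_sufficient :
  unified_product_conditions Omega -> forall u v w, defect u v w = 0.
Proof.
case=> L1 L2 L3 L4 L5 L6 L7 L8 L9 L10 L11 L12 L13 L14.
have Vgg x a b : defect (inV x) (inG a) (inG b) = 0.
  by rewrite defect_Vgg L1 L2 !subrr.
have ggV a b x : defect (inG a) (inG b) (inV x) = 0.
  by rewrite defect_ggV L3 L4 !subrr.
have VVV x y z : defect (inV x) (inV y) (inV z) = 0.
  by rewrite defect_VVV L5 L6 !subrr.
have VVg x y a : defect (inV x) (inV y) (inG a) = 0.
  by rewrite defect_VVg L7 L8 !subrr.
have gVV a x y : defect (inG a) (inV x) (inV y) = 0.
  by rewrite defect_gVV L9 L10 !subrr.
(* The swapped triples follow indirectly: the sum of two defects is zero by (L11)-(L14), and one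
   summand is already known to vanish. *)
have gVg a x b : defect (inG a) (inV x) (inG b) = 0.
  by have := defect_ggV_swap a b x; rewrite L11 L14 ggV add0r.
have VgV x a y : defect (inV x) (inG a) (inV y) = 0.
  by have := defect_VVg_swap x y a; rewrite L12 L13 VVg add0r.
have splitE a x : (a, x) = inG a + inV x by congr pair; rewrite /= ?bracket0.
move=> [a x] [b y] [c z]; rewrite (splitE a) (splitE b) (splitE c).
(* Expansion leaves eight defects, one for each choice of [g] or [V] in the three slots. *)
rewrite !leibniz_defectDl !leibniz_defectDm !leibniz_defectDr.
by rewrite defect_ggg Vgg ggV VVV VVg gVV gVg VgV !addr0.
Qed.

End UnifiedProductTheory.

Theorem theorem2p3 (k : fieldType) (g : leibnizAlgType k) (V : lmodType k)
    (Omega : extending_datum g V) :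
  is_unified_product Omega <-> unified_product_conditions Omega.
Proof.
split=> [/is_unified_productP | cond].
  exact: unified_product_conditions_necessary.
by apply/is_unified_productP; apply: unified_product_conditions_sufficient.
Qed.
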